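(* Let $\mathcal{G}$ be an ample Hausdorff groupoid with compact unit space $\mathcal{G}^{(0)}$. The representation $\pi\colon \mathbb{C}F(\mathcal{G}) \to A(\mathcal{G})$, $\pi(\delta_U) = 1_U$, of the topological full group of $\mathcal{G}$ in its complex Steinberg algebra is surjective if and only if $\mathcal{G}$ is a group.
   Context: A groupoid $\mathcal{G}$ is a small category in which every morphism is invertible, identified with its set of morphisms; all groupoids are assumed nonempty. Range and source are $r(\gamma)=\gamma\gamma^{-1}$, $s(\gamma)=\gamma^{-1}\gamma$; $\alpha\beta$ is defined if and only if $s(\alpha)=r(\beta)$; the unit space is $\mathcal{G}^{(0)}=r(\mathcal{G})=s(\mathcal{G})$. A groupoid is a group if and only if $\mathcal{G}^{(0)}$ is a singleton. A topological groupoid is a groupoid with a topology making composition and inversion continuous. A Hausdorff groupoid is a topological groupoid whose topology is locally compact Hausdorff. It is étale if $r,s\colon\mathcal{G}\to\mathcal{G}^{(0)}$ are local homeomorphisms. A bisection is a subset $B\subseteq\mathcal{G}$ on which $r$ and $s$ are both injective. An étale groupoid is ample if its topology has a basis of compact open bisections. For an ample Hausdorff groupoid $\mathcal{G}$, the complex Steinberg algebra $A(\mathcal{G})$ is the span of the characteristic functions $1_U\colon\mathcal{G}\to\mathbb{C}$ of compact open bisections $U$ of $\mathcal{G}$ (equivalently, the locally constant compactly supported functions $\mathcal{G} \to \mathbb{C}$), with convolution $(f*g)(\gamma)=\sum_{\alpha\beta=\gamma}f(\alpha)g(\beta)$ and involution $f^*(\gamma)=\overline{f(\gamma^{-1})}$.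 If $\mathcal{G}^{(0)}$ is compact, the topological full group $F(\mathcal{G})$ is the (discrete) group of all compact open bisections $B$ of $\mathcal{G}$ that are full, i.e. $r(B)=s(B)=\mathcal{G}^{(0)}$, with product $AB=\{\alpha\beta : \alpha\in A,\ \beta\in B,\ s(\alpha)=r(\beta)\}$ and inverse $B^{-1}=\{\gamma^{-1} : \gamma\in B\}$. The complex group ring $\mathbb{C}F(\mathcal{G})$ has basis $\{\delta_U : U\in F(\mathcal{G})\}$, and $\pi\colon\mathbb{C}F(\mathcal{G})\to A(\mathcal{G})$ is the $*$-homomorphism that is the linear extension of $\delta_U\mapsto 1_U$. *)

(* Defs.v *)
From HB Require Import structures.
From mathcomp Require Import all_boot all_order all_algebra.
From mathcomp Require Import finmap complex.
From mathcomp Require Import all_classical reals topology numfun.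
From mathcomp Require Import monalg.
Set Implicit Arguments. Unset Strict Implicit. Unset Printing Implicit Defensive.
Import Order.TTheory GRing.Theory Num.Theory.
Local Open Scope classical_set_scope.
Local Open Scope ring_scope.
Local Open Scope complex_scope.

(* The composition [gdmul] is total, but no axiom constrains its value at     *)
(* (a, b) unless s(a) = r(b), where s(a) = a^-1 a and r(b) = b b^-1.          *)
HB.mixin Record isGroupoid G := {
  gdmul : G -> G -> G;
  gdinv : G -> G;
  gd_inhabited : inhabited G;
  gdinvK : involutive gdinv;
  gdmul_rng : forall a b, gdmul (gdinv a) a = gdmul b (gdinv b) ->
    gdmul (gdmul a b) (gdinv (gdmul a b)) = gdmul a (gdinv a);
  gdmul_src : forall a b, gdmul (gdinv a) a = gdmul b (gdinv b) ->
    gdmul (gdinv (gdmul a b)) (gdmul a b) = gdmul (gdinv b) b;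
  gdmulA : forall a b c,
    gdmul (gdinv a) a = gdmul b (gdinv b) ->
    gdmul (gdinv b) b = gdmul c (gdinv c) ->
    gdmul a (gdmul b c) = gdmul (gdmul a b) c;
  gdmul_rngl : forall a, gdmul (gdmul a (gdinv a)) a = a;
  gdmul_srcr : forall a, gdmul a (gdmul (gdinv a) a) = a
}.

#[short(type="groupoidType")]
HB.structure Definition Groupoid := {G of isGroupoid G}.

Definition rng (G : groupoidType) (a : G) : G := gdmul a (gdinv a).
Definition src (G : groupoidType) (a : G) : G := gdmul (gdinv a) a.
Arguments rng {G} a.
Arguments src {G} a.

Definition composable (G : groupoidType) : set (G * G) :=
  [set p | src p.1 = rng p.2].
Arguments composable G : clear implicits.

Definition unit_space (G : groupoidType) : set G := range rng.
Arguments unit_space G : clear implicits.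

Definition is_group (G : groupoidType) : Prop :=
  exists u : G, unit_space G = [set u].

Definition bisection (G : groupoidType) (B : set G) : Prop :=
  set_inj B rng /\ set_inj B src.

Definition gdset_mul (G : groupoidType) (A B : set G) : set G :=
  [set gdmul p.1 p.2 | p in (A `*` B) `&` composable G].

Definition gdset_inv (G : groupoidType) (B : set G) : set G := @gdinv G @` B.

Section GroupoidTheory.
Variable G : groupoidType.
Implicit Types (a b c g : G) (A B : set G).

Lemma rngM a b : src a = rng b -> rng (gdmul a b) = rng a.
Proof. exact: gdmul_rng. Qed.

Lemma srcM a b : src a = rng b -> src (gdmul a b) = src b.
Proof. exact: gdmul_src. Qed.

Lemma mulgdA a b c : src a = rng b -> src b = rng c ->
  gdmul a (gdmul b c) = gdmul (gdmul a b) c.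
Proof. exact: gdmulA. Qed.

Lemma rngV a : rng (gdinv a) = src a.
Proof. by rewrite /rng gdinvK. Qed.

Lemma srcV a : src (gdinv a) = rng a.
Proof. by rewrite /src gdinvK. Qed.

Lemma mul_rng a : gdmul (rng a) a = a.
Proof. exact: gdmul_rngl. Qed.

Lemma mul_src a : gdmul a (src a) = a.
Proof. exact: gdmul_srcr. Qed.

Lemma rng_rng a : rng (rng a) = rng a.
Proof. by rewrite {2}/rng rngM// rngV. Qed.

Lemma src_rng a : src (rng a) = rng a.
Proof. by rewrite {2}/rng srcM ?srcV// rngV. Qed.

Lemma rng_src a : rng (src a) = src a.
Proof. by rewrite -(rngV a) rng_rng. Qed.

Lemma src_src a : src (src a) = src a.
Proof. by rewrite -(rngV a) src_rng. Qed.

Lemma unit_space_rng a : unit_space G (rng a).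
Proof. by exists a. Qed.

Lemma unit_space_src a : unit_space G (src a).
Proof. by exists (src a); rewrite // rng_src. Qed.

Lemma unit_spaceP a : unit_space G a -> rng a = a /\ src a = a.
Proof. by move=> [b _ <-]; rewrite rng_rng src_rng. Qed.

Lemma mulKg a b : src a = rng b -> gdmul (gdinv a) (gdmul a b) = b.
Proof. by move=> ab; rewrite mulgdA ?srcV// -/(src a) ab mul_rng. Qed.

Lemma mulVKg a b : rng a = rng b -> gdmul a (gdmul (gdinv a) b) = b.
Proof. by move=> ab; rewrite mulgdA ?rngV ?srcV// -/(rng a) ab mul_rng. Qed.

Lemma mulgK a b : src a = rng b -> gdmul (gdmul a b) (gdinv b) = a.
Proof. by move=> ab; rewrite -mulgdA ?rngV// -/(rng b) -ab mul_src. Qed.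

Lemma gdinvM a b : src a = rng b ->
  gdinv (gdmul a b) = gdmul (gdinv b) (gdinv a).
Proof.
move=> ab; have ba : src (gdinv b) = rng (gdinv a) by rewrite srcV rngV.
have xb : src (gdmul a b) = rng (gdinv b) by rewrite srcM// rngV.
have e : gdmul (gdmul a b) (gdmul (gdinv b) (gdinv a)) = rng (gdmul a b).
  by rewrite mulgdA// mulgK// rngM.
rewrite -[RHS](mulKg (a := gdmul a b)) ?rngM// e.
by rewrite -srcV mul_src.
Qed.

Lemma bisectionM A B : bisection A -> bisection B -> bisection (gdset_mul A B).
Proof.
move=> [rA sA] [rB sB]; split => x y; rewrite !inE.
  move=> -[[a b] /= [[Aa Bb] ab] <-] [[a' b'] /= [[Aa' Bb'] ab'] <-].
  rewrite !rngM// => raa'; have aa' : a = a' by apply: rA; rewrite ?inE.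
  by subst a'; congr gdmul; apply: rB; rewrite ?inE// -[LHS]ab -[RHS]ab'.
move=> -[[a b] /= [[Aa Bb] ab] <-] [[a' b'] /= [[Aa' Bb'] ab'] <-].
rewrite !srcM// => sbb'; have bb' : b = b' by apply: sB; rewrite ?inE.
by subst b'; congr gdmul; apply: sA; rewrite ?inE// [LHS]ab [RHS]ab'.
Qed.

Lemma bisectionV B : bisection B -> bisection (gdset_inv B).
Proof.
move=> [rB sB]; split => x y; rewrite !inE => -[a Ba <-] [b Bb <-].
  by rewrite !rngV => /sB ->//; rewrite inE.
by rewrite !srcV => /rB ->//; rewrite inE.
Qed.

Lemma bisection1 : bisection (unit_space G).
Proof.
by split => x y; rewrite !inE => /unit_spaceP[rx sx] /unit_spaceP[ry sy];
  rewrite ?rx ?ry ?sx ?sy.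
Qed.

Lemma gdset_mulA A B C :
  gdset_mul A (gdset_mul B C) = gdset_mul (gdset_mul A B) C.
Proof.
apply/seteqP; split => g.
  move=> [[a g'] /= [[Aa [[b c] /= [[Bb Cc] bc] <-]]]].
  rewrite /composable /= rngM// => ab <-.
  exists (gdmul a b, c) => /=; last by rewrite mulgdA.
  by split; [split => //; exists (a, b) | rewrite /composable /= srcM].
move=> [[g' c] /= [[[[a b] /= [[Aa Bb] ab] <-] Cc]]].
rewrite /composable /= srcM// => bc <-.
exists (a, gdmul b c) => /=; last by rewrite mulgdA.
by split; [split => //; exists (b, c) | rewrite /composable /= rngM].
Qed.

Lemma gdset_mul1 A : gdset_mul (unit_space G) A = A.
Proof.
apply/seteqP; split => g.
  move=> [[u a] /= [[/unit_spaceP[_ su] Aa]]]; rewrite /composable/= su => ->.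
  by rewrite mul_rng => <-.
move=> Ag; exists (rng g, g); rewrite /= ?mul_rng//.
by split; [split => //; exact: unit_space_rng | rewrite /composable/= src_rng].
Qed.

Lemma gdset_1mul A : gdset_mul A (unit_space G) = A.
Proof.
apply/seteqP; split => g.
  move=> [[a u] /= [[Aa /unit_spaceP[ru _]]]]; rewrite /composable/= ru => <-.
  by rewrite mul_src => <-.
move=> Ag; exists (g, src g); rewrite /= ?mul_src//.
by split; [split => //; exact: unit_space_src | rewrite /composable/= rng_src].
Qed.

Lemma gdset_mulV B : set_inj B src -> rng @` B = unit_space G ->
  gdset_mul B (gdset_inv B) = unit_space G.
Proof.
move=> sB <-; apply/seteqP; split => g.
  move=> [[a _] /= [[Ba [b Bb <-]]]]; rewrite /composable /= rngV => ab <-.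
  have -> : a = b by apply: sB; rewrite ?inE.
  by exists b.
move=> [b Bb <-]; exists (b, gdinv b) => //=.
by split; [split => //; exists b | rewrite /composable /= rngV].
Qed.

Lemma gdset_invK : involutive (@gdset_inv G).
Proof.
move=> B; rewrite /gdset_inv image_comp.
rewrite (_ : _ \o _ = id) ?image_id//; by apply/funext => x /=; rewrite gdinvK.
Qed.

Lemma rng_inv B : rng @` gdset_inv B = src @` B.
Proof.
rewrite /gdset_inv image_comp; congr image.
by apply/funext => x /=; rewrite rngV.
Qed.

Lemma src_inv B : src @` gdset_inv B = rng @` B.
Proof. by rewrite -rng_inv gdset_invK. Qed.

Lemma rng_mul A B : src @` A = unit_space G -> rng @` B = unit_space G ->
  rng @` gdset_mul A B = rng @` A.
Proof.
move=> sA rB; apply/seteqP; split => x.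
  by move=> [_ [[a b] /= [[Aa Bb] ab] <-] <-]; rewrite rngM//; exists a.
move=> [a Aa <-]; have : (rng @` B) (src a) by rewrite rB; exact: unit_space_src.
move=> [b Bb ba]; exists (gdmul a b); last by rewrite rngM.
by exists (a, b).
Qed.

Lemma src_mul A B : src @` A = unit_space G -> rng @` B = unit_space G ->
  src @` gdset_mul A B = src @` B.
Proof.
move=> sA rB; apply/seteqP; split => x.
  by move=> [_ [[a b] /= [[Aa Bb] ab] <-] <-]; rewrite srcM//; exists b.
move=> [b Bb <-]; have : (src @` A) (rng b) by rewrite sA; exact: unit_space_rng.
move=> [a Aa ab]; exists (gdmul a b); last by rewrite srcM.
by exists (a, b).
Qed.

Lemma rng_unit_space : rng @` unit_space G = unit_space G.
Proof.
apply/seteqP; split => x; first by move=> [a _ <-]; exact: unit_space_rng.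
by move=> ux; exists x; rewrite ?(unit_spaceP ux).1.
Qed.

Lemma src_unit_space : src @` unit_space G = unit_space G.
Proof.
apply/seteqP; split => x; first by move=> [a _ <-]; exact: unit_space_src.
by move=> ux; exists x; rewrite ?(unit_spaceP ux).2.
Qed.

End GroupoidTheory.

HB.mixin Record isTopologicalGroupoid G of Groupoid G & Topological G := {
  gdmul_continuous :
    {within composable G, continuous (fun p : G * G => gdmul p.1 p.2)};
  gdinv_continuous : continuous (@gdinv G)
}.

#[short(type="topologicalGroupoidType")]
HB.structure Definition TopologicalGroupoid :=
  {G of Groupoid G & Topological G & isTopologicalGroupoid G}.

Definition local_homeomorphism (X Y : topologicalType) (f : X -> Y) : Prop :=
  forall x : X, exists (U : set X) (g : Y -> X),
    [/\ open U, U x, open (f @` U),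
        {within U, continuous f} /\ {within f @` U, continuous g} &
        {in U, cancel f g}].

(* [rng] and [src] as maps into the unit space with the subspace topology,    *)
(* which is the topology of [set_type].                                       *)
Definition rng_unit (G : topologicalGroupoidType) (a : G) :
    set_type (unit_space G) :=
  exist _ (rng a) (mem_set (unit_space_rng a)).

Definition src_unit (G : topologicalGroupoidType) (a : G) :
    set_type (unit_space G) :=
  exist _ (src a) (mem_set (unit_space_src a)).

Definition etale (G : topologicalGroupoidType) : Prop :=
  local_homeomorphism (@rng_unit G) /\ local_homeomorphism (@src_unit G).

Definition compact_open_bisection (G : topologicalGroupoidType) (B : set G) :
  Prop := [/\ compact B, open B & bisection B].

HB.mixin Record isAmpleHausdorff G of TopologicalGroupoid G := {
  gd_hausdorff : hausdorff_space G;
  gd_locally_compact : locally_compact [set: G];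
  gd_etale : etale G;
  gd_ample : basis (@compact_open_bisection G)
}.

#[short(type="ampleHausdorffGroupoidType")]
HB.structure Definition AmpleHausdorffGroupoid :=
  {G of TopologicalGroupoid G & isAmpleHausdorff G}.

Section AmpleTheory.
Variable G : ampleHausdorffGroupoidType.
Implicit Types (a b g : G) (A B : set G).

Lemma gdmul_cvg (T : Type) (F : set_system T) (f h : T -> G) a b :
  Filter F -> src a = rng b -> (forall t, src (f t) = rng (h t)) ->
  f @ F --> a -> h @ F --> b -> (fun t => gdmul (f t) (h t)) @ F --> gdmul a b.
Proof.
move=> FF ab fh fa hb.
have /subspace_continuousP/(_ (a, b) ab) mc := @gdmul_continuous G.
move=> V /mc /=; rewrite /within /= nbhs_simpl /= => nV.
have fhab : (fun t => (f t, h t)) @ F --> (a, b) by exact: (cvg_pair fa hb).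
have : F [set t | composable G (f t, h t) -> V (gdmul (f t) (h t))].
  exact: fhab nV.
by apply: (@filterS _ F) => t /=; apply; exact: fh.
Qed.

Lemma rng_continuous : continuous (@rng G).
Proof.
move=> a; apply: (@gdmul_cvg _ (nbhs a) id (@gdinv G)); rewrite ?rngV//.
- by move=> t; rewrite rngV.
- exact: gdinv_continuous.
Qed.

Lemma src_continuous : continuous (@src G).
Proof.
move=> a; apply: (@gdmul_cvg _ (nbhs a) (@gdinv G) id); rewrite ?srcV//.
- by move=> t; rewrite srcV.
- exact: gdinv_continuous.
Qed.

Lemma closed_composable : closed (composable G).
Proof.
move=> [a b] cl /=; apply: (@gd_hausdorff G) => V W nV nW.
have sV : nbhs a (src @^-1` V) by exact: (src_continuous nV).
have rW : nbhs b (rng @^-1` W) by exact: (rng_continuous nW).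
have [|[a' b'] /= [ab' [Va' Wb']]] := cl (src @^-1` V `*` rng @^-1` W).
  by exists (src @^-1` V, rng @^-1` W).
by exists (src a'); split => //; rewrite [src a']ab'.
Qed.

Lemma compact_gdset_mul A B : compact A -> compact B -> compact (gdset_mul A B).
Proof.
move=> cA cB; apply: continuous_compact.
  exact: continuous_subspaceW (@gdmul_continuous G).
by apply: compact_closedI; [exact: compact_setX | exact: closed_composable].
Qed.

Lemma open_gdset_mul A B : open A -> open B -> open (gdset_mul A B).
Proof.
move=> oA oB; rewrite openE => _ [[a b] /= [[Aa Bb] ab] <-].
have [U [f [oU Ua oV [_ cf] fK]]] := (@gd_etale G).1 a.
pose phi g := f (rng_unit g).
have phia : phi (gdmul a b) = a.
  rewrite /phi (_ : rng_unit _ = rng_unit a); first by rewrite fK ?inE.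
  by apply/val_inj => /=; rewrite rngM.
have ru_cts : {for gdmul a b, continuous (@rng_unit G)}.
  move=> W [_ [[O oO <-] /= Oab] OW].
  have nO : nbhs (gdmul a b) (rng @^-1` O).
    by apply: rng_continuous; exact: open_nbhs_nbhs.
  by apply: (@filterS _ (nbhs (gdmul a b)) _ (rng @^-1` O)) => // g /= Og; exact: OW.
have Vab : (@rng_unit G @` U) (rng_unit (gdmul a b)).
  by exists a => //; apply/val_inj => /=; rewrite rngM.
have cphi : phi @ gdmul a b --> a.
  rewrite -[in X in _ --> X]phia; apply: (cvg_comp _ _ ru_cts).
  by move: cf; rewrite continuous_open_subspace// => /(_ _ (mem_set Vab)).
have nV : \forall g \near gdmul a b, (@rng_unit G @` U) (rng_unit g).
  by apply: ru_cts; exact: open_nbhs_nbhs.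
have rphi g : (@rng_unit G @` U) (rng_unit g) -> rng (phi g) = rng g.
  move=> [u Uu ug]; rewrite /phi -ug fK ?inE//.
  exact: (congr1 val ug).
pose psi g := if pselect ((@rng_unit G @` U) (rng_unit g)) then phi g else rng g.
have rpsi g : rng (psi g) = rng g.
  by rewrite /psi; case: pselect => Vg; [exact: rphi | exact: rng_rng].
have cpsi : psi @ gdmul a b --> a.
  apply: cvg_trans cphi; apply: near_eq_cvg.
  by apply: filterS nV => g Vg; rewrite /psi; case: pselect.
have cmul : (fun g => gdmul (gdinv (psi g)) g) @ gdmul a b --> b.
  rewrite -[in X in _ --> X](mulKg (ab : src a = rng b)); apply: (@gdmul_cvg _ (nbhs (gdmul a b)) (@gdinv G \o psi) id).
  - by rewrite srcV rngM.
  - by move=> g; rewrite srcV rpsi.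
  - apply: (cvg_comp _ _ cpsi); exact: gdinv_continuous.
  - by [].

have nA : nbhs (gdmul a b) (psi @^-1` A) by apply: cpsi; exact: open_nbhs_nbhs.
have nB : nbhs (gdmul a b) [set g | B (gdmul (gdinv (psi g)) g)].
  by apply: cmul; exact: open_nbhs_nbhs.
apply: filterS2 nA nB => g Ag Bg.
exists (psi g, gdmul (gdinv (psi g)) g) => /=; last by rewrite mulVKg.
by split => //; rewrite /composable /= rngM ?rngV// srcV rpsi.
Qed.

Lemma open_unit_space : open (unit_space G).
Proof.
rewrite openE => _ [a _ <-].
have [U [f [oU Ua _ _ fK]]] := (@gd_etale G).1 (rng a).
have nU : nbhs (rng a) U by exact: open_nbhs_nbhs.
have nrU : nbhs (rng a) (rng @^-1` U).
  by apply: rng_continuous; rewrite rng_rng.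
apply: filterS2 nU nrU => g Ug Urg; exists g => //.
rewrite -[LHS](fK (rng g)) ?inE// -[RHS](fK g) ?inE//; congr f.
by apply/val_inj => /=; rewrite rng_rng.
Qed.

Lemma compact_open_bisectionM A B : compact_open_bisection A ->
  compact_open_bisection B -> compact_open_bisection (gdset_mul A B).
Proof.
move=> [cA oA bA] [cB oB bB]; split; first exact: compact_gdset_mul.
  exact: open_gdset_mul.
exact: bisectionM.
Qed.

Lemma compact_open_bisectionV B : compact_open_bisection B ->
  compact_open_bisection (gdset_inv B).
Proof.
move=> [cB oB bB]; split; last exact: bisectionV.
  apply: continuous_compact => //.
  exact: (continuous_subspaceT (@gdinv_continuous G)).
rewrite (_ : gdset_inv B = @gdinv G @^-1` B).
  by apply: open_comp => // x _; exact: gdinv_continuous.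
apply/seteqP; split => g /=; first by move=> [b Bb <-]; rewrite /= gdinvK.
by move=> Bg; exists (gdinv g); rewrite ?gdinvK.
Qed.

Lemma compact_open_bisection1 : compact (unit_space G) ->
  compact_open_bisection (unit_space G).
Proof.
by move=> cG; split => //; [exact: open_unit_space | exact: bisection1].
Qed.

End AmpleTheory.

Definition full_bisection (G : groupoidType) (B : set G) : Prop :=
  rng @` B = unit_space G /\ src @` B = unit_space G.

Definition full_compact_open_bisection (G : topologicalGroupoidType)
  (B : set G) : Prop := compact_open_bisection B /\ full_bisection B.

(* The compactness of the unit space is a parameter of the type because the   *)
(* identity element of the group is the unit space itself.                    *)
Record full_group (G : ampleHausdorffGroupoidType)
    (cG : compact (unit_space G)) : Type := FullGroup {
  full_group_set :> set G;
  full_groupP : `[< full_compact_open_bisection full_group_set >] }.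

Section FullGroup.
Variables (G : ampleHausdorffGroupoidType) (cG : compact (unit_space G)).
Local Notation F := (full_group cG).

HB.instance Definition _ := [isSub for @full_group_set G cG].
HB.instance Definition _ := [Choice of F by <:].

Lemma full_group_compact_open_bisection (U : F) : compact_open_bisection U.
Proof. by have /asboolP[] := full_groupP U. Qed.

Lemma full_group_full (U : F) : full_bisection U.
Proof. by have /asboolP[] := full_groupP U. Qed.

Lemma full_group_mul_subproof (U V : F) :
  `[< full_compact_open_bisection (gdset_mul U V) >].
Proof.
have [rU sU] := full_group_full U; have [rV sV] := full_group_full V.
apply/asboolP; split; last by split; rewrite ?rng_mul ?src_mul.
by apply: compact_open_bisectionM; exact: full_group_compact_open_bisection.
Qed.

Lemma full_group_inv_subproof (U : F) :
  `[< full_compact_open_bisection (gdset_inv U) >].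
Proof.
have [rU sU] := full_group_full U.
apply/asboolP; split; last by split; rewrite ?rng_inv ?src_inv.
by apply: compact_open_bisectionV; exact: full_group_compact_open_bisection.
Qed.

Lemma full_group_one_subproof :
  `[< full_compact_open_bisection (unit_space G) >].
Proof.
apply/asboolP; split; first exact: compact_open_bisection1.
by split; [exact: rng_unit_space | exact: src_unit_space].
Qed.

Definition full_group_mul (U V : F) : F := FullGroup cG (full_group_mul_subproof U V).
Definition full_group_inv (U : F) : F := FullGroup cG (full_group_inv_subproof U).
Definition full_group_one : F := FullGroup cG full_group_one_subproof.

Lemma full_group_mulA : associative full_group_mul.
Proof. by move=> U V W; apply: val_inj; exact: gdset_mulA. Qed.

Lemma full_group_mul1 : left_id full_group_one full_group_mul.
Proof. by move=> U; apply: val_inj; exact: gdset_mul1. Qed.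

Lemma full_group_1mul : right_id full_group_one full_group_mul.
Proof. by move=> U; apply: val_inj; exact: gdset_1mul. Qed.

Lemma full_group_mulV : right_inverse full_group_one full_group_inv full_group_mul.
Proof.
move=> U; apply: val_inj; apply: gdset_mulV; last exact: (full_group_full U).1.
by have [_ _ []] := full_group_compact_open_bisection U.
Qed.

Lemma full_group_Vmul : left_inverse full_group_one full_group_inv full_group_mul.
Proof.
move=> U; rewrite -[X in full_group_mul _ X](_ : full_group_inv (full_group_inv U) = U).
  exact: full_group_mulV.
by apply: val_inj; exact: gdset_invK.
Qed.

HB.instance Definition _ := isGroup.Build F
  full_group_mulA full_group_mul1 full_group_1mul full_group_Vmul full_group_mulV.

End FullGroup.

Section Steinberg.
Variables (R : realType) (G : ampleHausdorffGroupoidType).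
Local Notation C := R[i].
Implicit Types (f h : G -> C) (U V : set G).

Definition steinberg_span f : Prop :=
  exists (n : nat) (c : 'I_n -> C) (U : 'I_n -> set G),
    (forall i, compact_open_bisection (U i)) /\
    f = \sum_(i < n) c i *: (\1_(U i) : G -> C).

(* A big sum over a set is 0 when its support is infinite; this does not      *)
(* happen for [f] in the span, see [conv_supp_finite].                        *)
Definition convolution f h : G -> C := fun g =>
  \sum_(p \in [set p | composable G p /\ gdmul p.1 p.2 = g]) f p.1 * h p.2.

Definition involution f : G -> C := fun g => conjc (f (gdinv g)).

Lemma steinberg_span_ind (P : (G -> C) -> Prop) :
  P 0 -> (forall f h, P f -> P h -> P (f + h)) ->
  (forall c U, compact_open_bisection U -> P (c *: (\1_U : G -> C))) ->
  forall f, steinberg_span f -> P f.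
Proof.
move=> P0 PD PZ f [n [c [U [Ub ->]]]].
by elim/big_ind : _ => // i _; exact: PZ.
Qed.

Lemma steinberg_spanZ1 c U : compact_open_bisection U ->
  steinberg_span (c *: (\1_U : G -> C)).
Proof.
by move=> Ub; exists 1, (fun=> c), (fun=> U); split => //; rewrite big_ord1.
Qed.

Lemma steinberg_span0 : steinberg_span 0.
Proof.
exists 0, (fun=> 0), (fun=> set0); split; last by rewrite big_ord0.
by case.
Qed.

Lemma steinberg_spanD f h :
  steinberg_span f -> steinberg_span h -> steinberg_span (f + h).
Proof.
move=> [n [c [U [Ub ->]]]] [m [d [V [Vb ->]]]].
exists (n + m)%N, (fun i => match fintype.split i with inl j => c j | inr j => d j end).
exists (fun i => match fintype.split i with inl j => U j | inr j => V j end).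
split; first by move=> i; case: (fintype.split i).
rewrite big_split_ord /=; congr (_ + _); apply: eq_bigr => i _.
  by rewrite -[lshift _ _]/(unsplit (inl i)) unsplitK.
by rewrite -[rshift _ _]/(unsplit (inr i)) unsplitK.
Qed.

Lemma steinberg_spanZ c f : steinberg_span f -> steinberg_span (c *: f).
Proof.
elim/steinberg_span_ind => {f} [|f h cf ch|d U Ub].
- by rewrite scaler0; exact: steinberg_span0.
- by rewrite scalerDr; exact: steinberg_spanD.
- by rewrite scalerA; exact: steinberg_spanZ1.
Qed.

Definition steinberg_pred : {pred G -> C} := fun f => `[< steinberg_span f >].

Lemma steinberg_pred_closed : GRing.submod_closed steinberg_pred.
Proof.
split; first exact/asboolP/steinberg_span0.
move=> c f h /asboolP sf /asboolP sh; apply/asboolP.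
by apply: steinberg_spanD => //; exact: steinberg_spanZ.
Qed.

HB.instance Definition _ :=
  GRing.isSubmodClosed.Build C (G -> C) steinberg_pred steinberg_pred_closed.

Record steinberg : Type := Steinberg {
  steinberg_fun :> G -> C;
  steinbergP : steinberg_fun \in steinberg_pred }.

HB.instance Definition _ := [isSub for steinberg_fun].
HB.instance Definition _ := [Choice of steinberg by <:].
HB.instance Definition _ := [SubChoice_isSubLmodule of steinberg by <:].

Lemma steinberg_spanP (f : steinberg) : steinberg_span f.
Proof. exact/asboolP/steinbergP. Qed.

Definition fibre_finite f :=
  forall u, finite_set [set a | rng a = u /\ f a != 0].

Lemma steinberg_fibre_finite f : steinberg_span f -> fibre_finite f.
Proof.
elim/steinberg_span_ind => {f} [u|f h ff fh u|c U [_ _ [rU _]] u].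
- apply: (sub_finite_set _ (finite_set0 G)) => a /= [_].
  by rewrite [(0 : G -> C) a]/(0 : C) eqxx.
- apply: (sub_finite_set _ (_ : finite_set
      ([set a | rng a = u /\ f a != 0] `|` [set a | rng a = u /\ h a != 0]))).
    move=> a /= [au]; have -> : (f + h) a = f a + h a by [].
    have [->|fa _] := eqVneq (f a) 0; last by left; split.
    by rewrite add0r => ha; right; split.
  by rewrite finite_setU.
- have cE a : (c *: (\1_U : G -> C)) a = c * (a \in U)%:R by [].
  have [[b [bu Ub]]|nU] := pselect (exists a, rng a = u /\ U a).
    apply: (sub_finite_set _ (finite_set1 b)) => a /= [au].
    rewrite cE; case: (asboolP (U a)) => Ua.
      by move=> _; apply: rU; rewrite ?inE// au bu.
    by rewrite memNset// mulr0 eqxx.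
  apply: (sub_finite_set _ (finite_set0 G)) => a /= [au].
  rewrite cE memNset ?mulr0 ?eqxx//.
  by move=> Ua; apply: nU; exists a.
Qed.

Lemma convolution_widen f h (D : set (G * G)) g :
  D `<=` [set p | composable G p /\ gdmul p.1 p.2 = g] ->
  (forall p, composable G p -> gdmul p.1 p.2 = g -> f p.1 != 0 -> D p) ->
  convolution f h g = \sum_(p \in D) f p.1 * h p.2.
Proof.
move=> DP fD; apply/esym/fsbig_widen => // p [[pc pg] nD] /=.
have [->|f0] := eqVneq (f p.1) 0; first by rewrite mul0r.
by case: nD; exact: fD.
Qed.

Lemma conv_supp_finite f g : fibre_finite f ->
  finite_set [set p | (composable G p /\ gdmul p.1 p.2 = g) /\ f p.1 != 0].
Proof.
move=> /(_ (rng g)) ff.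
apply: (sub_finite_set _ (finite_image (fun a => (a, gdmul (gdinv a) g)) ff)).
move=> [a b] /= [[ab <-] fa]; exists a; first by rewrite rngM.
by rewrite mulKg.
Qed.

Lemma convolutionDl f1 f2 h : fibre_finite f1 -> fibre_finite f2 ->
  convolution (f1 + f2) h = convolution f1 h + convolution f2 h.
Proof.
move=> ff1 ff2; apply/funext => g.
pose D := [set p | (composable G p /\ gdmul p.1 p.2 = g) /\ f1 p.1 != 0] `|`
          [set p | (composable G p /\ gdmul p.1 p.2 = g) /\ f2 p.1 != 0].
have DP : D `<=` [set p | composable G p /\ gdmul p.1 p.2 = g].
  by move=> p [][].
have -> : (convolution f1 h + convolution f2 h) g =
  convolution f1 h g + convolution f2 h g by [].
rewrite !(@convolution_widen _ _ D)//.
- rewrite -fsbig_split; last by rewrite finite_setU; split; exact: conv_supp_finite.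
  by apply: eq_fsbigr => p _; exact: mulrDl.
- by right.
- by left.
- move=> p pc pg; have -> : (f1 + f2) p.1 = f1 p.1 + f2 p.1 by [].
  have [->|fa _] := eqVneq (f1 p.1) 0; last by left.
  by rewrite add0r => fa; right.
Qed.

Lemma convolutionDr f h1 h2 : fibre_finite f ->
  convolution f (h1 + h2) = convolution f h1 + convolution f h2.
Proof.
move=> ff; apply/funext => g.
pose D := [set p | (composable G p /\ gdmul p.1 p.2 = g) /\ f p.1 != 0].
have DP : D `<=` [set p | composable G p /\ gdmul p.1 p.2 = g] by move=> p [].
have -> : (convolution f h1 + convolution f h2) g =
  convolution f h1 g + convolution f h2 g by [].
rewrite !(@convolution_widen _ _ D)//.
rewrite -fsbig_split; last exact: conv_supp_finite.
by apply: eq_fsbigr => p _; exact: mulrDr.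
Qed.

Lemma convolutionZl c f h : convolution (c *: f) h = c *: convolution f h.
Proof.
apply/funext => g; have -> : (c *: convolution f h) g = c * convolution f h g by [].
rewrite /convolution mulr_fsumr.
apply: eq_fsbigr => p _.
by have -> : (c *: f) p.1 = c * f p.1 by []; rewrite mulrA.
Qed.

Lemma convolutionZr c f h : convolution f (c *: h) = c *: convolution f h.
Proof.
apply/funext => g; have -> : (c *: convolution f h) g = c * convolution f h g by [].
rewrite /convolution mulr_fsumr.
apply: eq_fsbigr => p _.
by have -> : (c *: h) p.2 = c * h p.2 by []; rewrite mulrCA.
Qed.

Lemma convolution0l h : convolution 0 h = 0.
Proof. by have := convolutionZl 0 0 h; rewrite !scale0r. Qed.

Lemma convolution0r f : convolution f 0 = 0.
Proof. by have := convolutionZr 0 f 0; rewrite !scale0r. Qed.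

Lemma convolution_indic U V : bisection U ->
  convolution (\1_U) (\1_V) = \1_(gdset_mul U V).
Proof.
move=> [rU _]; apply/funext => g; rewrite indicE.
case: (asboolP (gdset_mul U V g)) => [[[a b] /= [[Ua Vb] ab] abg]|nUV].
  rewrite mem_set; last by exists (a, b).
  rewrite (@convolution_widen _ _ [set (a, b)]).
  - by rewrite fsbig_set1 /= !indicE !mem_set// mulr1.
  - by move=> _ ->.
  - move=> [a' b'] /= ab' abg' ; rewrite indicE.
    case: (asboolP (U a')) => Ua'; last by rewrite memNset// eqxx.
    have aa' : a = a'.
      by apply: rU; rewrite ?inE// -(rngM ab) -(rngM ab') abg abg'.
    subst a' => _; congr (_, _).
    by rewrite -[LHS](mulKg (ab' : src a = rng b')) [gdmul a b']abg' -abg mulKg.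
rewrite memNset// /convolution fsbig1// => -[a b] /= [ab abg].
rewrite !indicE; case: (asboolP (U a)) => Ua; last by rewrite memNset// mul0r.
case: (asboolP (V b)) => Vb; last by rewrite (memNset Vb) mulr0.
by case: nUV; exists (a, b).
Qed.

Lemma convolution_span f h : steinberg_span f -> steinberg_span h ->
  steinberg_span (convolution f h).
Proof.
move=> sf sh.
suff [] : steinberg_span (convolution f h) /\ steinberg_span f by [].
elim/steinberg_span_ind : sf => {f} [|f1 f2 [s1 sf1] [s2 sf2]|c U Ub].
- by rewrite convolution0l; split; exact: steinberg_span0.
- split; last exact: steinberg_spanD.
  rewrite convolutionDl; [exact: steinberg_spanD| |];
    exact: steinberg_fibre_finite.
- split; last exact: steinberg_spanZ1.
  rewrite convolutionZl; apply: steinberg_spanZ.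
  have U1 : fibre_finite (\1_U : G -> C).
    by apply: steinberg_fibre_finite; rewrite -[\1_U]scale1r; exact: steinberg_spanZ1.
  elim/steinberg_span_ind : sh => {h} [|h1 h2 s1 s2|d V Vb].
  + by rewrite convolution0r; exact: steinberg_span0.
  + by rewrite convolutionDr//; exact: steinberg_spanD.
  + rewrite convolutionZr convolution_indic; last by case: Ub.
    by apply: steinberg_spanZ1; exact: compact_open_bisectionM.
Qed.

Lemma involutionZ1 c U :
  involution (c *: (\1_U : G -> C)) = conjc c *: (\1_(gdset_inv U) : G -> C).
Proof.
apply/funext => g; rewrite /involution.
have -> : (c *: (\1_U : G -> C)) (gdinv g) = c * (gdinv g \in U)%:R by [].
have -> : (conjc c *: (\1_(gdset_inv U) : G -> C)) g =
  conjc c * (g \in gdset_inv U)%:R by [].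
rewrite rmorphM rmorph_nat; congr (_ * _%:R); congr nat_of_bool.
apply/idP/idP; rewrite !inE; first by move=> Ug; exists (gdinv g); rewrite ?gdinvK.
by move=> [a Ua <-]; rewrite gdinvK.
Qed.

Lemma involutionD f h : involution (f + h) = involution f + involution h.
Proof. by apply/funext => g; exact: rmorphD. Qed.

Lemma involution_span f : steinberg_span f -> steinberg_span (involution f).
Proof.
elim/steinberg_span_ind => {f} [|f h sf sh|c U Ub].
- rewrite (_ : involution 0 = 0); first exact: steinberg_span0.
  by apply/funext => g; exact: rmorph0.
- by rewrite involutionD; exact: steinberg_spanD.
- rewrite involutionZ1; apply: steinberg_spanZ1.
  exact: compact_open_bisectionV.
Qed.

Lemma indic_span U : compact_open_bisection U -> steinberg_span (\1_U : G -> C).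
Proof. by move=> Ub; rewrite -[\1_U]scale1r; exact: steinberg_spanZ1. Qed.

Definition steinberg_mul (f h : steinberg) : steinberg :=
  Steinberg (asboolT (convolution_span (steinberg_spanP f) (steinberg_spanP h))).

Definition steinberg_star (f : steinberg) : steinberg :=
  Steinberg (asboolT (involution_span (steinberg_spanP f))).

Definition steinberg_indic U (Ub : compact_open_bisection U) : steinberg :=
  Steinberg (asboolT (indic_span Ub)).

Lemma steinberg_mulDl (h : steinberg) : {morph steinberg_mul^~ h : f1 f2 / f1 + f2}.
Proof.
by move=> f1 f2; apply: val_inj; apply: convolutionDl;
  apply: steinberg_fibre_finite; exact: steinberg_spanP.
Qed.

Lemma steinberg_mulDr (f : steinberg) : {morph steinberg_mul f : h1 h2 / h1 + h2}.
Proof.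
by move=> h1 h2; apply: val_inj; apply: convolutionDr;
  apply: steinberg_fibre_finite; exact: steinberg_spanP.
Qed.

Lemma steinberg_mulZl c (f h : steinberg) : steinberg_mul (c *: f) h = c *: steinberg_mul f h.
Proof. by apply: val_inj; exact: convolutionZl. Qed.

Lemma steinberg_mulZr c (f h : steinberg) : steinberg_mul f (c *: h) = c *: steinberg_mul f h.
Proof. by apply: val_inj; exact: convolutionZr. Qed.

Lemma steinberg_mul0l (h : steinberg) : steinberg_mul 0 h = 0.
Proof. by apply: val_inj; exact: convolution0l. Qed.

Lemma steinberg_mul0r (f : steinberg) : steinberg_mul f 0 = 0.
Proof. by apply: val_inj; exact: convolution0r. Qed.

Lemma steinberg_starD : {morph steinberg_star : f h / f + h}.
Proof. by move=> f h; apply: val_inj; exact: involutionD. Qed.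

Lemma steinberg_star0 : steinberg_star 0 = 0.
Proof. by apply: val_inj; apply/funext => g; exact: rmorph0. Qed.

Lemma steinberg_starZ c (f : steinberg) : steinberg_star (c *: f) = conjc c *: steinberg_star f.
Proof. by apply: val_inj; apply/funext => g; exact: rmorphM. Qed.

End Steinberg.

Section GroupRing.
Variables (R : realType) (K : groupType).
Local Notation C := R[i].

(* The library's multiplication on [{malg C[K]}] is only available when [K] is *)
(* a monoid without nontrivial units, which excludes groups.                  *)
Implicit Types a b : {malg C[K]}.

Definition group_ring_mul a b : {malg C[K]} :=
  \sum_(U <- msupp a) \sum_(V <- msupp b) << a@_U * b@_V *g (U * V)%g >>.

Definition group_ring_star a : {malg C[K]} :=
  \sum_(U <- msupp a) << conjc a@_U *g (U^-1)%g >>.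

End GroupRing.

Section Representation.
Variables (R : realType) (G : ampleHausdorffGroupoidType).
Variable cG : compact (unit_space G).
Local Notation C := R[i].
Local Notation F := (full_group cG).
Implicit Types a b : {malg C[F]}.

Definition full_group_indic (U : F) : steinberg R G :=
  steinberg_indic R (full_group_compact_open_bisection U).

Definition full_group_rep a : steinberg R G :=
  \sum_(U <- msupp a) a@_U *: full_group_indic U.

Lemma full_group_repEw (d : {fset F}) a : (msupp a `<=` d)%fset ->
  full_group_rep a = \sum_(U <- d) a@_U *: full_group_indic U.
Proof.
move=> ad; apply: big_fset_incl => // U _ /mcoeff_outdom ->.
by rewrite scale0r.
Qed.

Lemma full_group_rep_is_linear : linear full_group_rep.
Proof.
move=> c a b; pose d := (msupp a `|` msupp b)%fset.
rewrite (@full_group_repEw d a) ?fsubsetUl// (@full_group_repEw d b) ?fsubsetUr//.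
rewrite (@full_group_repEw d); last first.
  apply: (fsubset_trans (msuppD_le _ _)); apply: fsetSU; exact: msuppZ_le.
rewrite scaler_sumr -big_split; apply: eq_bigr => U _ /=.
by rewrite mcoeffD mcoeffZ scalerDl scalerA.
Qed.

HB.instance Definition _ := GRing.isLinear.Build C {malg C[F]} (steinberg R G) _
  full_group_rep full_group_rep_is_linear.

Lemma full_group_repU c (U : F) :
  full_group_rep << c *g U >> = c *: full_group_indic U.
Proof. by rewrite (full_group_repEw msuppU_le) big_seq_fset1 mcoeffUU. Qed.

Lemma full_group_rep_delta (U : F) : full_group_rep << U >> = full_group_indic U.
Proof. by rewrite full_group_repU scale1r. Qed.

Lemma full_group_rep_mul a b : full_group_rep (group_ring_mul a b) =
  steinberg_mul (full_group_rep a) (full_group_rep b).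
Proof.
rewrite /group_ring_mul linear_sum [full_group_rep a]/full_group_rep.
rewrite (big_morph _ (steinberg_mulDl _) (steinberg_mul0l _)).
apply: eq_bigr => U _; rewrite linear_sum [full_group_rep b]/full_group_rep.
rewrite (big_morph _ (steinberg_mulDr _) (steinberg_mul0r _)).
apply: eq_bigr => V _ /=.
rewrite full_group_repU steinberg_mulZl steinberg_mulZr scalerA; congr (_ *: _).
apply: val_inj => /=; rewrite convolution_indic//.
by case: (full_group_compact_open_bisection U).
Qed.

Lemma full_group_rep_star a :
  full_group_rep (group_ring_star a) = steinberg_star (full_group_rep a).
Proof.
rewrite /group_ring_star linear_sum [full_group_rep a]/full_group_rep.
rewrite (big_morph _ (@steinberg_starD _ _) (@steinberg_star0 _ _)).
apply: eq_bigr => U _ /=; rewrite full_group_repU steinberg_starZ; congr (_ *: _).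
apply: val_inj => /=; have := involutionZ1 (1 : C) U.
by rewrite scale1r rmorph1 scale1r.
Qed.

End Representation.

(* Main.v *)
Require Import Defs.
From mathcomp Require Import all_boot all_order all_algebra.
From mathcomp Require Import finmap complex.
From mathcomp Require Import all_classical reals topology.
From mathcomp Require Import numfun.
From mathcomp Require Import monalg.
Import GRing.Theory.
Local Open Scope classical_set_scope.
Local Open Scope ring_scope.
Local Open Scope complex_scope.

(** Convolving f on the right with the constant function 1 gives the function
    sending g to the sum of f over the range fibre through g.  If U is a full
    bisection, each range fibre meets U exactly once, so the indicator of U is
    sent to the constant 1; by linearity every element of the image of the
    representation is sent to a constant ([full_group_rep_fibre_sum]).  In
    other words, an element of the image has the same sum over all range
    fibres.

    If there are two distinct units u and v, the Steinberg algebra contains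
    the indicator of a compact open set W of units with u in W and v not in W
    ([unit_separation]), whose fibre sums at u and v are 1 and 0; so the
    representation is not surjective.

    If there is only one unit, every nonempty subset has the whole unit space
    as its range and as its source ([group_full_bisection]), so each generator
    of the Steinberg algebra is 0 or the image of an element of the full
    group. *)

Section FibreSums.
Variables (R : realType) (G : ampleHausdorffGroupoidType).
Local Notation C := R[i].
Implicit Types U : set G.

Lemma gdset_mulT U : gdset_mul U [set: G] = rng @^-1` (rng @` U).
Proof.
apply/seteqP; split => g.
  by move=> [[a b] /= [[Ua _] ab] <-]; exists a; rewrite ?rngM.
move=> [a Ua ag]; exists (a, gdmul (gdinv a) g) => /=; last by rewrite Defs.mulVKg.
by split => //; rewrite /composable /= rngM ?rngV ?srcV.
Qed.

(** Fibre sums are expressed as convolutions with the constant function 1 so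
    that their linearity is that of [convolution]. *)
Lemma fibre_sum_indic U : bisection U ->
  convolution (\1_U : G -> C) \1_[set: G] = \1_(rng @^-1` (rng @` U)).
Proof. by move=> bU; rewrite convolution_indic// gdset_mulT. Qed.

(** The constant is the augmentation of a, the sum of its coefficients: a full
    bisection meets every range fibre exactly once. *)
Lemma full_group_rep_fibre_sum {cG : compact (unit_space G)}
    (a : {malg C[full_group cG]}) :
  exists c : C, convolution (full_group_rep a) \1_[set: G] = cst c.
Proof.
rewrite /full_group_rep; elim/big_ind: _ => [|f h [c fc] [d hd]|U _].
- by exists 0; apply/funext => g; rewrite convolution0l.
- exists (c + d).
  have ff (k : steinberg R G) : fibre_finite k.
    exact/steinberg_fibre_finite/steinberg_spanP.
  have -> : (f + h : steinberg R G) = (f : G -> C) + h :> (G -> C) by [].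
  by rewrite convolutionDl// fc hd.
- exists a@_U; have [_ _ bU] := full_group_compact_open_bisection U.
  have -> : (a@_U *: full_group_indic R U) = a@_U *: (\1_U : G -> C) :> (G -> C).
    by [].
  rewrite convolutionZl fibre_sum_indic//; apply/funext => g.
  have -> : rng @^-1` (rng @` U) = [set: G].
    rewrite (full_group_full U).1; apply/seteqP; split => // x _.
    exact: unit_space_rng.
  by rewrite indicT /= -[LHS]/(_ * 1) mulr1.
Qed.

End FibreSums.

(** The unit space of an etale groupoid is open, so a basic neighbourhood of u
    that avoids v can be taken inside it. *)
Lemma unit_separation {G : ampleHausdorffGroupoidType} {u v : G} :
  unit_space G u -> u != v ->
  exists W : set G, [/\ compact_open_bisection W, W `<=` unit_space G, W u & ~ W v].
Proof.
move=> Gu uv; have := @gd_hausdorff G; rewrite open_hausdorff.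
move=> /(_ u v uv) [[A B] /= [uA vB] [oA oB AB0]].
have nuA : nbhs u (A `&` unit_space G).
  apply: open_nbhs_nbhs; split; first exact: openI (open_unit_space G).
  by split=> //; rewrite inE in uA.
have [W [bW Wu] WA] := (@gd_ample G).2 u _ nuA.
exists W; split => // [x /WA[]//|/WA[Av _]].
have : (A `&` B) v by split=> //; rewrite inE in vB.
by rewrite (eqP AB0).
Qed.

Lemma group_full_bisection {G : groupoidType} {u : G} {U : set G} :
  unit_space G = [set u] -> U !=set0 -> full_bisection U.
Proof.
move=> Gu [a Ua].
have ru x : rng x = u by have := unit_space_rng x; rewrite Gu.
have su x : src x = u by have := unit_space_src x; rewrite Gu.
rewrite /full_bisection Gu; split; apply/seteqP; split => [x [b _ <-]|x ->] //=.
- by exists a.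
- by exists a.
Qed.

Lemma rep_surjective_is_group (R : realType) (G : ampleHausdorffGroupoidType)
    (cG : compact (unit_space G)) :
  (forall f : steinberg R G,
      exists a : {malg R[i][full_group cG]}, full_group_rep a = f) -> is_group G.
Proof.
move=> surj; have [g] := gd_inhabited (s := G).
exists (rng g); apply/seteqP; split => [v Gv|_ ->]; last exact: unit_space_rng.
apply: contrapT => /eqP; rewrite eq_sym => gv.
have [W [bW WG Wg Wv]] := unit_separation (unit_space_rng g) gv.
have [a aW] := surj (steinberg_indic R bW).
have [c] := full_group_rep_fibre_sum _ _ a.
(* W separates rng g from v, so its fibre sums there, 1 and 0, differ. *)
rewrite aW /= fibre_sum_indic; last by have [] := bW.
move=> sumc; have := congr1 (@^~ v) sumc; rewrite -[RHS](congr1 (@^~ (rng g)) sumc).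
rewrite /= !indicE memNset; last first.
  move=> [w Ww]; rewrite (unit_spaceP Gv).1 (unit_spaceP (WG _ Ww)).1 => wv.
  by apply: Wv; rewrite -wv.
rewrite mem_set; last by exists (rng g).
by move/eqP; rewrite eq_sym oner_eq0.
Qed.

Lemma is_group_rep_surjective (R : realType) (G : ampleHausdorffGroupoidType)
    (cG : compact (unit_space G)) : is_group G ->
  forall f : steinberg R G,
    exists a : {malg R[i][full_group cG]}, full_group_rep a = f.
Proof.
move=> [u Gu] f.
suff [a af] : exists a : {malg R[i][full_group cG]},
    full_group_rep a = f :> (G -> R[i]) by exists a; exact: val_inj.
elim/steinberg_span_ind: (steinberg_spanP f) => {f} [|f h [a <-] [b <-]|c U bU].
- by exists 0; rewrite linear0.
- by exists (a + b); rewrite linearD.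
- have [->|/set0P U0] := eqVneq U set0.
    by exists 0; rewrite linear0 indic0 scaler0.
  have fU : `[< full_compact_open_bisection U >].
    by apply/asboolP; split => //; exact: group_full_bisection Gu U0.
  by exists << c *g FullGroup cG fU >>; rewrite full_group_repU.
Qed.

Theorem corollary4p4 (R : realType) (G : ampleHausdorffGroupoidType)
    (cG : compact (unit_space G)) :
  (forall f : steinberg R G,
      exists a : {malg R[i][full_group cG]}, full_group_rep a = f)
  <-> is_group G.
Proof.
split; first exact: rep_surjective_is_group.
exact: is_group_rep_surjective.
Qed.
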